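(* Let $\mu \ge 0$ be a fixed real number and, for each $\nu$, let $Y = Y_\nu$ have the Conway--Maxwell--Poisson (CMP) distribution with dispersion $\nu$ and mean $\mu$, that is, with rate $\lambda = \lambda(\mu,\nu)$ chosen so that $E(Y_\nu) = \mu$. Then, as $\nu \to \infty$, the distribution of $Y_\nu$ converges to: (i) a unit point mass at $\mu$ if $\mu$ is an integer, i.e., $P(Y_\nu = \mu) \to 1$; (ii) a shifted Bernoulli distribution on the two integers $\lfloor \mu \rfloor$ and $\lceil \mu \rceil$ if $\mu$ is not an integer, with $P(Y_\nu = \lfloor \mu \rfloor) \to 1 - \Delta$ and $P(Y_\nu = \lceil \mu \rceil) \to \Delta$, where $\Delta = \mu - \lfloor \mu \rfloor$.
   Context: The Conway--Maxwell--Poisson (CMP) distribution with rate $\lambda \ge 0$ and dispersion $\nu \ge 0$ is the distribution on the non-negative integers with probability mass function $$P(Y = y) = \frac{1}{Z(\lambda,\nu)} \frac{\lambda^y}{(y!)^\nu}, \quad y = 0,1,2,\ldots, \qquad Z(\lambda,\nu) = \sum_{y=0}^\infty \frac{\lambda^y}{(y!)^\nu}$$ (with the convention $0^0 = 1$). The CMP distribution with mean $\mu$ and dispersion $\nu$ (mean parametrization) is the one whose rate $\lambda = \lambda(\mu,\nu)$ is the solution of the mean constraint $$0 = \sum_{y=0}^\infty (y - \mu) \frac{\lambda^y}{(y!)^\nu}.$$ *)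

(* Defs.v *)
From HB Require Import structures.
From mathcomp Require Import all_boot all_order all_algebra.
From mathcomp Require Import all_classical all_reals all_analysis.

Set Implicit Arguments.
Unset Strict Implicit.
Unset Printing Implicit Defensive.

Import Order.TTheory GRing.Theory Num.Theory.
Import numFieldNormedType.Exports.

Local Open Scope classical_set_scope.
Local Open Scope ring_scope.

(* Since [0 ^+ 0 = 1], the convention 0^0 = 1 holds. *)
Definition cmp_weight (R : realType) (lam nu : R) (y : nat) : R :=
  lam ^+ y / (y`!%:R `^ nu).

(* A junk value when the series diverges; [is_cmp] below requires convergence. *)
Definition cmp_Z (R : realType) (lam nu : R) : R :=
  limn (series (cmp_weight lam nu)).

Definition cmp_pmf (R : realType) (lam nu : R) (y : nat) : R :=
  cmp_weight lam nu y / cmp_Z lam nu.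

(* The masses at the naturals sum to 1, so they determine the law of [Y], as a
   real random variable, completely. *)
Definition is_cmp (R : realType) d (T : measurableType d) (P : probability T R)
    (Y : {RV P >-> R}) (lam nu : R) : Prop :=
  [/\ 0 <= lam, 0 <= nu, cvgn (series (cmp_weight lam nu)) &
      forall y : nat, P (Y @^-1` [set y%:R]) = (cmp_pmf lam nu y)%:E].

(* For [0 <= nu] and [0 <= mu] such a rate exists and is unique, so this relation
   defines the function [lam(mu, nu)]. *)
Definition is_mean_rate (R : realType) (mu nu lam : R) : Prop :=
  0 <= lam /\
  series (fun y : nat => (y%:R - mu) * cmp_weight lam nu y) @ \oo --> (0 : R).

Definition is_cmp_mean (R : realType) d (T : measurableType d)
    (P : probability T R) (Y : {RV P >-> R}) (mu nu : R) : Prop :=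
  exists lam : R, is_mean_rate mu nu lam /\ is_cmp Y lam nu.

(* Convergence of the distribution functions at the continuity points of the
   limit distribution function. *)
Definition cvg_in_law (R : realType) (I : Type) (F : set_system I)
    (d : I -> measure_display) (T : forall i, measurableType (d i))
    (P : forall i, probability (T i) R) (X : forall i, {RV (P i) >-> R})
    (L : probability R R) : Prop :=
  forall x : R, {for x, continuous (fun t : R => L `]-oo, t]%classic)} ->
    cdf (X i) x @[i --> F] --> L `]-oo, x]%classic.

Definition shift_bool (R : realType) (a : R) (b : bool) : R := a + b%:R.

Lemma measurable_shift_bool (R : realType) (a : R) :
  measurable_fun [set: bool] (shift_bool a).
Proof. by []. Qed.

HB.instance Definition _ (R : realType) (a : R) :=
  isMeasurableFun.Build _ _ _ _ (shift_bool a) (measurable_shift_bool a).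

(* The law of [a + B], with [B] Bernoulli of parameter [p]. *)
Definition shifted_bernoulli (R : realType) (a p : R) : probability R R :=
  distribution (bernoulli_prob p) (shift_bool a).

(* Main.v *)
Require Import Defs.
From mathcomp Require Import all_boot all_order all_algebra.
From mathcomp Require Import all_classical all_reals all_analysis.
From mathcomp Require Import ring lra.
Import Order.TTheory GRing.Theory Num.Theory.
Import numFieldNormedType.Exports.
Local Open Scope classical_set_scope.
Local Open Scope ring_scope.

(** Write [p_y] for the masses of the law with mean [mu] and dispersion [nu],
    [n] for the floor of [mu], and [Delta = mu - n], a number of [[0, 1[].  Only
    the total mass, the mean and the recurrence [p_(y+1) (y+1)^nu = lam p_y] are
    used.

    The rate is controlled by Jensen's inequality.  By the recurrence,
    [lam E[(Y+1)^-nu] = P(Y >= 1) <= 1], while convexity of [x |-> x^-nu] gives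
    [E[(Y+1)^-nu] >= (mu+1)^-nu]; hence [lam <= (mu+1)^nu] ([cmp_rate_le]).  The
    recurrence also says that [E[Y^nu] = lam], so Markov's inequality makes the
    part of the mean carried by [y >= m] at most [m ((mu+1)/m)^nu]
    ([cmp_tail_le]).  This vanishes for [m = n+2 > mu+1]: nothing is lost above
    [n+1].

    Put [D = p_(n+1)], [L = sum_(y<n) (n-y) p_y] and
    [rest = sum_(y>=n+2) (y-n) p_y].  The mean constraint is the balance
    [D + rest = Delta + L], where [rest] tends to 0 ([cmp_mean_balance]).  Below
    [n], the recurrence bounds products of masses on the two sides of [n]:
    [p_y p_(n+1) <= ((y+1)/(n+1))^nu] ([cmp_masses_mul_le]), so [D L] tends to 0.
    From the balance,
    [[
      (D - Delta)^2 = (D - Delta) (L - rest) <= D L + Delta rest,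
    ]]
    so [D] tends to [Delta], then [L] to 0, and the mass that remains, [p_n], to
    [1 - Delta] ([cmp_masses_cvg]).  Integral and non-integral means are treated
    together: an integral [mu] is the case [Delta = 0].

    Since the two limits add up to 1, no mass escapes, and the convergence of the
    two masses forces the convergence of the distribution function at every point
    ([cvg_in_law_two_atoms]). *)

(** * Real powers *)

Lemma powR_div {R : realType} (a b nu : R) : 0 <= a -> 0 <= b ->
  (a / b) `^ nu = a `^ nu / b `^ nu.
Proof.
move=> a0 b0; rewrite powRM ?invr_ge0// -(powR_inv1 b0) powRAC.
by rewrite powR_inv1 ?powR_ge0.
Qed.

(** With x^(-nu) = exp (- nu ln x), both exp t >= 1 + t and ln x <= x - 1 push
    in the same direction, so the tangent of x |-> x^(-nu) at 1 stays below the
    graph. *)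
Lemma powR_ge_tangentN {R : realType} (nu x : R) : 0 <= nu -> 0 < x ->
  1 - nu * (x - 1) <= (x `^ nu)^-1.
Proof.
move=> nu0 x0; rewrite -powRN /powR gt_eqF//.
apply: le_trans (expR_ge1Dx _); rewrite mulNr lerD2l lerN2 ler_wpM2l//.
have := @le_ln1Dx R (x - 1); rewrite (addrC 1) subrK; apply.
by rewrite ltrBrDr addrC subrr.
Qed.

Lemma cvg_powR0 {R : realType} (a : R) : 0 < a -> a < 1 ->
  a `^ nu @[nu --> +oo] --> 0.
Proof.
move=> a0 a1; have la : 0 < - ln a by rewrite oppr_gt0 ln_lt0// a0.
rewrite (_ : powR a = (fun x => expR (- x)) \o (fun nu => nu * - ln a)).
  exact: cvg_comp (gt0_cvgMly la cvg_id) (@cvgr_expR R).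
by apply/funext => nu; rewrite /= /powR gt_eqF// mulrN opprK.
Qed.

(** * Masses of a Conway--Maxwell--Poisson law of given mean *)

(** The recurrence is multiplicative rather than a quotient of consecutive
    masses, so that it covers the rate [lam = 0], where all masses but [p 0]
    vanish. *)
Definition cmp_masses {R : realType} (mu nu lam : R) (p : R^nat) : Prop :=
  [/\ 0 <= lam, forall y, 0 <= p y,
      series p @ \oo --> (1 : R),
      series (fun y => (y%:R - mu) * p y) @ \oo --> (0 : R) &
      forall y, p y.+1 * y.+1%:R `^ nu = lam * p y].

Lemma cmp_pmf_masses {R : realType} (mu nu lam : R) :
  is_mean_rate mu nu lam -> cvgn (series (cmp_weight lam nu)) ->
  cmp_masses mu nu lam (cmp_pmf lam nu).
Proof.
move=> [lam0 mean] cvZ.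
have w0 y : 0 <= cmp_weight lam nu y.
  by rewrite /cmp_weight divr_ge0 ?exprn_ge0 ?powR_ge0.
have Z1 : 1 <= cmp_Z lam nu.
  have -> : 1 = series (cmp_weight lam nu) 1%N.
    by rewrite /series /= big_nat1 /cmp_weight expr0 fact0 powR1 divr1.
  apply: nondecreasing_cvgn_le cvZ _.
  by apply: nondecreasing_series => k _.
have Z0 : 0 < cmp_Z lam nu by exact: lt_le_trans Z1.
have wS y : cmp_weight lam nu y.+1 * y.+1%:R `^ nu = lam * cmp_weight lam nu y.
  rewrite /cmp_weight factS natrM powRM// exprS invfM.
  by field; rewrite !gt_eqF ?powR_gt0// ltr0n fact_gt0.
split=> // [y|||y].
- by rewrite divr_ge0// ltW.
- rewrite -(mulVf (lt0r_neq0 Z0)) (_ : series _ =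
      fun N => (cmp_Z lam nu)^-1 * series (cmp_weight lam nu) N).
    exact: cvgMl_tmp.
  by apply/funext => N; rewrite /series /= mulr_sumr; apply: eq_bigr => k _;
    rewrite mulrC.
- rewrite -(mulr0 (cmp_Z lam nu)^-1) (_ : series _ = fun N => (cmp_Z lam nu)^-1 *
      series (fun y => (y%:R - mu) * cmp_weight lam nu y) N).
    exact: cvgMl_tmp.
  by apply/funext => N; rewrite /series /= mulr_sumr; apply: eq_bigr => k _;
    rewrite /cmp_pmf; ring.
- by rewrite /cmp_pmf mulrAC wS mulrA.
Qed.

Lemma cmp_masses_le1 {R : realType} {mu nu lam : R} {p : R^nat} (N : nat) :
  cmp_masses mu nu lam p -> \sum_(0 <= y < N) p y <= 1.
Proof.
move=> [_ p0 p1 _ _].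
have -> : 1 = limn (series p) by exact/esym/cvg_lim.
apply: nondecreasing_cvgn_le; last by apply/cvg_ex; exists 1.
by apply: nondecreasing_series => k _ _.
Qed.

(** * Bounds at a fixed dispersion *)

(** Jensen's inequality for x |-> x^(-nu): the tangent at mu + 1, integrated
    against the law of Y + 1, gives (mu+1)^(-nu) <= E[(Y+1)^(-nu)], and lam times
    the right-hand side is 1 - p_0.  The estimate is summed up to N and passed to
    the limit, and everything is multiplied by lam (mu+1)^nu to avoid dividing by
    a rate that may be 0. *)
Lemma cmp_rate_le {R : realType} {mu nu lam : R} {p : R^nat} :
  0 <= mu -> 0 <= nu -> cmp_masses mu nu lam p -> lam <= (mu + 1) `^ nu.
Proof.
move=> mu0 nu0 pP; have [lam0 p0 p1 pm pS] := pP.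
have m1 : 0 < mu + 1 by rewrite ltr_wpDl.
(* c is minus the logarithmic derivative of x^(-nu) at mu + 1. *)
pose c := nu / (mu + 1).
have step y : lam * (p y - c * ((y%:R - mu) * p y)) <= (mu + 1) `^ nu * p y.+1.
  have y1 : 0 < y.+1%:R :> R by [].
  have := @powR_ge_tangentN _ nu (y.+1%:R / (mu + 1)) nu0 (divr_gt0 y1 m1).
  rewrite powR_div ?(ltW m1)// invf_div.
  have -> : 1 - nu * (y.+1%:R / (mu + 1) - 1) = 1 - c * (y%:R - mu).
    by rewrite /c -natr1; field; rewrite gt_eqF.
  have q0 : 0 <= p y.+1 * y.+1%:R `^ nu by rewrite mulr_ge0 ?powR_ge0.
  move=> /(ler_wpM2r q0); rewrite {1}pS.
  rewrite [leRHS](_ : _ = (mu + 1) `^ nu * p y.+1); last first.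
    by field; rewrite gt_eqF// powR_gt0.
  by apply: le_trans; rewrite le_eqVlt; apply/orP; left; apply/eqP; ring.
apply: (@ler_cvg_to _ \oo _ _
   (fun N => lam * (series p N - c * series (fun y => (y%:R - mu) * p y) N))
   (fun=> (mu + 1) `^ nu)).
- rewrite -[X in _ --> X](_ : lam * (1 - c * 0) = lam); last by rewrite mulr0 subr0 mulr1.
  by apply: cvgMl_tmp; apply: cvgB => //; apply: cvgMl_tmp.
- exact: cvg_cst.
- near=> N.
  rewrite /series /= mulr_sumr -sumrB mulr_sumr.
  apply: (le_trans (ler_sum _ (fun y _ => step y))).
  rewrite -mulr_sumr -[leRHS]mulr1 ler_wpM2l ?powR_ge0//.
  apply: le_trans (cmp_masses_le1 N.+1 pP).
  by rewrite big_nat_recl//= lerDr.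
Unshelve. all: by end_near. Qed.

(** Markov's inequality for the moment E[Y^nu], which equals lam by the
    recurrence: for y >= m and nu >= 1, y is at most m (y/m)^nu. *)
Lemma cmp_tail_le {R : realType} {mu nu lam : R} {p : R^nat} (m N : nat) :
  0 <= mu -> 1 <= nu -> cmp_masses mu nu lam p -> (0 < m)%N ->
  \sum_(m <= y < N) y%:R * p y <= m%:R * ((mu + 1) / m%:R) `^ nu.
Proof.
move=> mu0 nu1 pP m_gt0; have [lam0 p0 p1 pm pS] := pP.
have mR : 0 < m%:R :> R by rewrite ltr0n.
have nu0 : 0 <= nu by exact: le_trans nu1.
have B0 : 0 <= m%:R / m%:R `^ nu :> R by rewrite divr_ge0 ?powR_ge0 ?ltW.
case: (leqP N m) => [Nm|mN].
  by rewrite big_geq// mulr_ge0 ?powR_ge0 ?ltW.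
have lamE : lam * (m%:R / m%:R `^ nu) <= m%:R * ((mu + 1) / m%:R) `^ nu.
  have m1 : 0 <= mu + 1 by rewrite addr_ge0.
  rewrite powR_div// mulrCA ler_wpM2l ?(ltW mR)// ler_wpM2r ?invr_ge0 ?powR_ge0//.
  exact: cmp_rate_le pP.
apply: le_trans lamE.
rewrite -[leRHS]mulr1.
apply: (@le_trans _ _ (\sum_(m <= y < N) lam * (m%:R / m%:R `^ nu) * p y.-1)).
  rewrite big_nat_cond [leRHS]big_nat_cond; apply: ler_sum => -[|y].
    by rewrite leqn0 -[m == _]negbK -lt0n m_gt0.
  rewrite andbT => /andP[my _] /=.
  have ym : 1 <= y.+1%:R / m%:R :> R by rewrite ler_pdivlMr// mul1r ler_nat.
  have := le1r_powR ym nu1; rewrite powR_div ?(ltW mR)//.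
  move=> /(ler_wpM2r (mulr_ge0 (ltW mR) (p0 y.+1))).
  rewrite [leLHS](_ : _ = y.+1%:R * p y.+1); last by field; rewrite gt_eqF.
  rewrite [leRHS](_ : _ = m%:R / m%:R `^ nu * (p y.+1 * y.+1%:R `^ nu)); last by ring.
  by rewrite pS mulrCA mulrA.
rewrite -mulr_sumr ler_wpM2l//; first by rewrite mulr_ge0.
case: m m_gt0 mN {mR B0} => // m _ mN; rewrite big_add1/=.
apply: le_trans (cmp_masses_le1 N.-1 pP).
rewrite [leRHS](@big_cat_nat _ _ _ m) ?lerDr ?sumr_ge0//.
by rewrite -ltnS (ltn_predK mN) ltnW.
Qed.

(** The middle expression is the mean constraint solved for the first moment
    about n of the masses above n + 1.  That moment dominates the total of those
    masses, because y - n >= 1 there, and is dominated by the tail of the mean,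
    estimated with m = n + 2, the least integer that exceeds mu + 1 when n is the
    floor of mu. *)
Lemma cmp_mean_balance {R : realType} {mu nu lam : R} {p : R^nat} (n : nat) :
  0 <= mu -> 1 <= nu -> cmp_masses mu nu lam p ->
  1 - \sum_(0 <= y < n.+2) p y
    <= mu - n%:R + \sum_(0 <= y < n) (n%:R - y%:R) * p y - p n.+1
    <= n.+2%:R * ((mu + 1) / n.+2%:R) `^ nu.
Proof.
move=> mu0 nu1 pP; have [lam0 p0 p1 pm pS] := pP.
set L := \sum_(0 <= y < n) _; set D := p n.+1.
pose rest N := \sum_(n.+2 <= y < N) (y%:R - n%:R) * p y.
have restE N : (n.+2 <= N)%N -> rest N =
    series (fun y => (y%:R - mu) * p y) N + (mu - n%:R) * series p N + L - D.
  move=> nN; rewrite /series /= mulr_sumr -big_split/=.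
  under [in RHS]eq_bigr do rewrite -mulrDl addrA subrK.
  rewrite (@big_cat_nat _ _ _ n.+2 0 N)//= -/(rest N).
  rewrite !big_nat_recr//= subrr mul0r addr0.
  have -> : n.+1%:R - n%:R = 1 :> R by rewrite -natrB// subSnn.
  rewrite mul1r.
  have -> : \sum_(0 <= y < n) (y%:R - n%:R) * p y = - L.
    by rewrite -sumrN; apply: eq_bigr => y _; rewrite -mulNr opprB.
  by rewrite /D; ring.
have cvg_rest : rest @ \oo --> mu - n%:R + L - D.
  have : (fun N => series (fun y => (y%:R - mu) * p y) N +
      (mu - n%:R) * series p N + L - D) @ \oo --> 0 + (mu - n%:R) * 1 + L - D.
    apply: cvgB; last exact: cvg_cst.
    apply: cvgD; last exact: cvg_cst.
    by apply: cvgD => //; apply: cvgMl_tmp.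
  rewrite add0r mulr1; apply: cvg_trans; apply: near_eq_cvg.
  by near=> N; rewrite restE//; near: N; exact: nbhs_infty_ge.
apply/andP; split.
- apply: (@ler_cvg_to _ \oo _ _ (fun N => series p N - \sum_(0 <= y < n.+2) p y)
     rest) => //; first by apply: cvgB => //; exact: cvg_cst.
  near=> N; have nN : (n.+2 <= N)%N by near: N; exact: nbhs_infty_ge.
  rewrite /series /= (@big_cat_nat _ _ _ n.+2 0 N)//= addrAC subrr add0r.
  rewrite /rest big_nat_cond [leRHS]big_nat_cond; apply: ler_sum => y.
  rewrite andbT => /andP[ny _]; rewrite ler_peMl// lerBrDr.
  by rewrite addrC natr1 ler_nat; apply: ltnW.
- apply: (@ler_cvg_to _ \oo _ _ rest (fun=> n.+2%:R * ((mu + 1) / n.+2%:R) `^ nu)).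
  + exact: cvg_rest.
  + exact: cvg_cst.
  + near=> N; apply: le_trans (cmp_tail_le n.+2 N mu0 nu1 pP isT).
    by apply: ler_sum => y _; rewrite ler_wpM2r// gerBl.
Unshelve. all: by end_near. Qed.

(** Moving one unit from n + 1 down to n and another from y up to y + 1 cancels
    the rate: p_y p_(n+1) = p_(y+1) p_n ((y+1)/(n+1))^nu.  For y < n this
    vanishes as nu grows: no mass can stay on both sides of n. *)
Lemma cmp_masses_mul_le {R : realType} {mu nu lam : R} {p : R^nat} (y n : nat) :
  cmp_masses mu nu lam p ->
  p y * p n.+1 <= (y.+1%:R / n.+1%:R) `^ nu.
Proof.
move=> pP; have [lam0 p0 p1 pm pS] := pP.
have ple1 k : p k <= 1.
  apply: le_trans (cmp_masses_le1 k.+1 pP).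
  by rewrite big_nat_recr//= lerDr sumr_ge0.
rewrite powR_div// ler_pdivlMr ?powR_gt0// -mulrA pS mulrCA mulrA -pS.
rewrite mulrAC -[leRHS]mul1r ler_wpM2r ?powR_ge0//.
by rewrite mulr_ile1.
Qed.

(** * Limit of the two central masses *)

Lemma cmp_masses_cvg {R : realType} {mu : R} {n : nat} {p : R -> R^nat} :
  n%:R <= mu -> mu < n.+1%:R ->
  (forall nu, 0 <= nu -> exists lam, cmp_masses mu nu lam (p nu)) ->
  p nu n.+1 @[nu --> +oo] --> mu - n%:R /\
  p nu n @[nu --> +oo] --> 1 - (mu - n%:R).
Proof.
move=> nmu mun pP.
have mu0 : 0 <= mu by apply: le_trans nmu.
set Delta := mu - n%:R; have Delta0 : 0 <= Delta by rewrite subr_ge0.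
pose L nu := \sum_(0 <= y < n) (n%:R - y%:R) * p nu y.
pose B (nu : R) : R := n.+2%:R * ((mu + 1) / n.+2%:R) `^ nu.
pose rest nu := Delta + L nu - p nu n.+1.
have bal nu : 1 <= nu -> 1 - \sum_(0 <= y < n.+2) p nu y <= rest nu <= B nu.
  move=> nu1; have [lam lamP] := pP nu (le_trans ler01 nu1).
  exact: cmp_mean_balance mu0 nu1 lamP.
have le1 nu : 1 <= nu -> \sum_(0 <= y < n.+2) p nu y <= 1.
  move=> nu1; have [lam lamP] := pP nu (le_trans ler01 nu1).
  exact: cmp_masses_le1 lamP.
have p0 nu y : 1 <= nu -> 0 <= p nu y.
  by move=> nu1; have [lam []] := pP nu (le_trans ler01 nu1).
have L0 nu : 1 <= nu -> 0 <= L nu.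
  move=> nu1; rewrite /L big_nat_cond sumr_ge0// => y; rewrite andbT => /andP[_ yn].
  by rewrite mulr_ge0 ?p0// subr_ge0 ler_nat ltnW.
have rest0 nu : 1 <= nu -> 0 <= rest nu.
  by move=> nu1; case/andP: (bal _ nu1) => + _; apply: le_trans; rewrite subr_ge0 le1.
have B_cvg : B nu @[nu --> +oo] --> 0.
  rewrite -(mulr0 n.+2%:R); apply: cvgMl_tmp; apply: cvg_powR0.
    by rewrite divr_gt0// ltr_wpDl.
  by rewrite ltr_pdivrMr// mul1r -(natr1 n.+1) ltrD2r.
have rest_cvg : rest nu @[nu --> +oo] --> 0.
  apply: (@squeeze_cvgr _ _ _ _ (fun=> 0) B) => //; last exact: cvg_cst.
  near=> nu; have nu1 : 1 <= nu by near: nu; exact: nbhs_pinfty_ge.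
  by rewrite rest0//=; case/andP: (bal _ nu1).
(* E bounds (D - Delta)^2: its first part bounds D L term by term, and the two
   nonnegative products D rest and Delta L are dropped. *)
pose E nu := \sum_(0 <= y < n) (n%:R - y%:R) * (y.+1%:R / n.+1%:R) `^ nu
   + Delta * rest nu.
have E_cvg : E nu @[nu --> +oo] --> 0.
  rewrite -[X in _ --> X](_ : 0 + Delta * 0 = 0); last by rewrite mulr0 addr0.
  apply: cvgD; last exact: cvgMl_tmp.
  rewrite [X in _ --> X](_ : _ = \sum_(0 <= y < n) ((n%:R - y%:R) * 0 : R)); last first.
    by rewrite big1// => y _; rewrite mulr0.
  under eq_cvg do rewrite big_nat_cond.
  rewrite big_nat_cond.
  apply: cvg_big; first exact: add_continuous.
  move=> y; rewrite andbT => /andP[_ yn].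
  apply: cvgMl_tmp; apply: cvg_powR0; first by rewrite divr_gt0.
  by rewrite ltr_pdivrMr// mul1r ltr_nat.
have sqE nu : 1 <= nu -> (p nu n.+1 - Delta) ^+ 2 <= E nu.
  move=> nu1.
  have -> : (p nu n.+1 - Delta) ^+ 2 = p nu n.+1 * L nu + Delta * rest nu
      - (p nu n.+1 * rest nu + Delta * L nu) by rewrite /rest; ring.
  rewrite lerBlDr; apply: le_trans (_ : E nu <= _); last first.
    by rewrite lerDl addr_ge0// mulr_ge0 ?p0 ?L0 ?rest0.
  rewrite lerD2r mulr_sumr big_nat_cond [leRHS]big_nat_cond.
  apply: ler_sum => y; rewrite andbT => /andP[_ yn].
  rewrite mulrCA ler_wpM2l//; first by rewrite subr_ge0 ler_nat ltnW.
  have [lam lamP] := pP nu (le_trans ler01 nu1).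
  by rewrite mulrC; apply: cmp_masses_mul_le lamP.
have D_cvg : p nu n.+1 @[nu --> +oo] --> Delta.
  apply: cvg_sub0 (cvg_cst Delta); apply: (@squeeze_cvgr _ _ _ _
    (fun nu => - Num.sqrt (E nu)) (fun nu => Num.sqrt (E nu))).
  - near=> nu; have nu1 : 1 <= nu by near: nu; exact: nbhs_pinfty_ge.
    by rewrite -ler_norml -sqrtr_sqr ler_wsqrtr ?sqE.
  - rewrite -oppr0 -(sqrtr0 R); apply: cvgN.
    by apply: continuous_cvg => //; exact: sqrt_continuous.
  - by rewrite -(sqrtr0 R); apply: continuous_cvg => //; exact: sqrt_continuous.
split => //.
have L_cvg : L nu @[nu --> +oo] --> 0.
  rewrite (_ : L = fun nu => rest nu + (p nu n.+1 - Delta)); last first.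
    by apply/funext => nu; rewrite /rest; ring.
  rewrite -[X in _ --> X](_ : 0 + (Delta - Delta) = 0); last by rewrite subrr addr0.
  by apply: cvgD => //; apply: cvgB => //; exact: cvg_cst.
(* L also bounds the mass below n, as n - y >= 1 there. *)
apply: (@squeeze_cvgr _ _ _ _ (fun nu => 1 - rest nu - L nu - p nu n.+1)
   (fun nu => 1 - p nu n.+1)).
- near=> nu; have nu1 : 1 <= nu by near: nu; exact: nbhs_pinfty_ge.
  have := le1 _ nu1; have /andP[+ _] := bal _ nu1.
  rewrite !big_nat_recr//=.
  have S0 : 0 <= \sum_(0 <= y < n) p nu y by rewrite sumr_ge0// => y _; exact: p0.
  have SL : \sum_(0 <= y < n) p nu y <= L nu.
    rewrite big_nat_cond /L [leRHS]big_nat_cond; apply: ler_sum => y.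
    rewrite andbT => /andP[_ yn]; rewrite ler_peMl ?p0//.
    by rewrite lerBrDr addrC natr1 ler_nat.
  by move: S0 SL; set S := \sum_(0 <= y < n) _; lra.
- rewrite -[X in _ --> X](_ : 1 - 0 - 0 - Delta = 1 - Delta); last by rewrite !subr0.
  by do 3 apply: cvgB => //; exact: cvg_cst.
- by apply: cvgB => //; exact: cvg_cst.
Unshelve. all: by end_near. Qed.

(** * Convergence in law to two atoms *)

(** For any probability Q, the atoms a and b bound Q A from below, and, applied
    to the complement of A, from above.  When the limiting masses of the atoms
    add up to 1 the two bounds have the same limit, which is also L A; this holds
    for every measurable A, hence at every point of the line and not only where
    the limiting distribution function is continuous. *)
Lemma cvg_in_law_two_atoms {R : realType} (I : Type) (F : set_system I)
    (FF : Filter F) (d : I -> measure_display)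
    (T : forall i, measurableType (d i)) (P : forall i, probability (T i) R)
    (X : forall i, {RV (P i) >-> R}) (L : probability R R) (a b u v : R) :
  a != b -> u + v = 1 -> L [set a] = u%:E -> L [set b] = v%:E ->
  fine (P i (X i @^-1` [set a])) @[i --> F] --> u ->
  fine (P i (X i @^-1` [set b])) @[i --> F] --> v ->
  cvg_in_law F X L.
Proof.
move=> ab uv La Lb Xa Xb x _.
(* S A s t is the mass of A for the masses s at a and t at b. *)
pose S (A : set R) (s t : R) : R := \1_A a * s + \1_A b * t.
have SleQ (Q : probability R R) (A : set R) : measurable A ->
    ((S A (fine (Q [set a])) (fine (Q [set b])))%:E <= Q A)%E.
  move=> mA; rewrite /S !indicE.
  have [qa qb] : (fine (Q [set a]))%:E = Q [set a] /\
      (fine (Q [set b]))%:E = Q [set b] by rewrite !fineK ?fin_num_measure.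
  have [aA|aA] := boolP (a \in A); have [bA|bA] := boolP (b \in A);
    rewrite ?mul1r ?mul0r ?addr0 ?add0r.
  - rewrite EFinD qa qb -measureU//; last first.
      by apply/seteqP; split=> // t [/= -> /eqP]; rewrite (negbTE ab).
    apply: le_measure; rewrite ?inE//; first exact: measurableU.
    by move=> t [->|->]; exact: set_mem.
  - by rewrite qa; apply: le_measure; rewrite ?inE// => t ->; exact: set_mem.
  - by rewrite qb; apply: le_measure; rewrite ?inE// => t ->; exact: set_mem.
  - exact: measure_ge0.
have Qle1S (Q : probability R R) (A : set R) : measurable A ->
    (Q A <= (1 - S (~` A) (fine (Q [set a])) (fine (Q [set b])))%:E)%E.
  move=> mA; have := SleQ Q _ (measurableC mA).
  rewrite probability_setC// -(@fineK _ (Q A)) ?fin_num_measure//.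
  by rewrite -EFinB !lee_fin lerBrDr addrC -lerBrDr.
have S1 A : S A u v = 1 - S (~` A) u v.
  have -> : v = 1 - u by rewrite -uv addrC addKr.
  by rewrite /S !indicE !in_setC; do 2 case: (_ \in A); rewrite /=; ring.
have LE : L `]-oo, x]%classic = (S `]-oo, x]%classic u v)%:E.
  apply/eqP; rewrite eq_le; apply/andP; split.
    by rewrite S1; have := Qle1S L `]-oo, x]%classic; rewrite La Lb; apply.
  by have := SleQ L `]-oo, x]%classic; rewrite La Lb; apply.
rewrite LE; apply: (@squeeze_cvge _ _ _ _
  (fun i => (S `]-oo, x]%classic (fine (P i (X i @^-1` [set a])))
     (fine (P i (X i @^-1` [set b]))))%:E) _
  (fun i => (1 - S (~` `]-oo, x]%classic) (fine (P i (X i @^-1` [set a])))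
     (fine (P i (X i @^-1` [set b]))))%:E)).
- near=> i; rewrite /cdf; apply/andP; split.
  + exact: (SleQ (distribution (P i) (X i))).
  + exact: (Qle1S (distribution (P i) (X i))).
- apply: cvg_EFin; first exact: nearW.
  by apply: cvgD; apply: cvgMl_tmp.
- rewrite S1; apply: cvg_EFin; first exact: nearW.
  by apply: cvgB; [exact: cvg_cst|apply: cvgD; apply: cvgMl_tmp].
Unshelve. all: by end_near. Qed.

Lemma shifted_bernoulli_set1 {R : realType} (a : R) {p : R} (b : bool) : 0 <= p <= 1 ->
  shifted_bernoulli a p [set a + b%:R] = (if b then p else 1 - p)%:E.
Proof.
move=> p01.
rewrite [LHS](_ : _ = bernoulli_prob p (shift_bool a @^-1` [set a + b%:R]))//.
have -> : shift_bool a @^-1` [set a + b%:R] = [set b].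
  apply/seteqP; split=> [c /= /addrI/eqP|c /= ->//].
  by rewrite eqr_nat; case: b c => -[].
rewrite /= bernoulli_probE// !diracE.
by case: b; rewrite !in_set1 /= ?mule1 ?mule0 ?adde0 ?add0e.
Qed.

(** * The limit law *)

Theorem proposition1 (R : realType) (mu : R)
    (d : R -> measure_display) (T : forall nu : R, measurableType (d nu))
    (P : forall nu : R, probability (T nu) R)
    (Y : forall nu : R, {RV (P nu) >-> R}) :
  0 <= mu ->
  (forall nu : R, 0 <= nu -> is_cmp_mean (Y nu) mu nu) ->
  (mu \is a Num.int ->
     cvg_in_law +oo Y \d_mu /\
     P nu (Y nu @^-1` [set mu]) @[nu --> +oo] --> 1%:E) /\
  (mu \isn't a Num.int ->
     let Delta := mu - (Num.floor mu)%:~R in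
     [/\ cvg_in_law +oo Y (shifted_bernoulli (Num.floor mu)%:~R Delta),
         P nu (Y nu @^-1` [set (Num.floor mu)%:~R]) @[nu --> +oo]
           --> (1 - Delta)%:E
       & P nu (Y nu @^-1` [set (Num.ceil mu)%:~R]) @[nu --> +oo]
           --> Delta%:E]).
Proof.
move=> mu0 YP.
pose n := `|Num.floor mu|%N.
have floorE : (Num.floor mu)%:~R = n%:R :> R.
  by rewrite -[in LHS](@gez0_abs (Num.floor mu)) ?floor_ge0.
have nmu : n%:R <= mu by rewrite -floorE floor_le.
have mun : mu < n.+1%:R by rewrite -natr1 -floorE -[1]/(1%:~R) -intrD floorD1_gt.
pose p nu y := fine (P nu (Y nu @^-1` [set y%:R])).
have massE nu y : P nu (Y nu @^-1` [set y%:R]) = (p nu y)%:E.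
  by rewrite fineK// fin_num_measure.
have pP nu : 0 <= nu -> exists lam, cmp_masses mu nu lam (p nu).
  move=> /YP[lam [mean [_ _ cvZ pmf]]]; exists lam.
  rewrite (_ : p nu = cmp_pmf lam nu); first exact: cmp_pmf_masses.
  by apply/funext => y; rewrite /p pmf.
have [pS_cvg pn_cvg] := cmp_masses_cvg nmu mun pP.
have masscvg y l : p nu y @[nu --> +oo] --> l ->
    P nu (Y nu @^-1` [set y%:R]) @[nu --> +oo] --> l%:E.
  move=> pl; under eq_cvg do rewrite massE.
  by apply: cvg_EFin => //; exact: nearW.
have nSn : n%:R != n.+1%:R :> R by rewrite eqr_nat ltn_eqF.
split=> [muint|muint Delta].
- have muE : mu = n%:R by rewrite -floorE; apply/esym/eqP; rewrite -intrEfloor.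
  rewrite muE subrr subr0 in pS_cvg pn_cvg.
  rewrite muE; split; last exact: masscvg.
  apply: (@cvg_in_law_two_atoms _ _ _ _ _ _ _ Y _ n%:R n.+1%:R 1 0 nSn) => //.
  + by rewrite addr0.
  + by rewrite [LHS]diracE mem_set.
  + by rewrite [LHS]diracE memNset//= => /eqP; rewrite (negbTE nSn).
- have ceilE : (Num.ceil mu)%:~R = n.+1%:R :> R.
    by rewrite ceil_floor muint intrD floorE natr1.
  rewrite /Delta ceilE floorE; split; [|exact: masscvg|exact: masscvg].
  have Delta01 : 0 <= mu - n%:R <= 1.
    by rewrite subr_ge0 nmu lerBlDl natr1 ltW.
  apply: (@cvg_in_law_two_atoms _ _ _ _ _ _ _ Y _ n%:R n.+1%:R
    (1 - (mu - n%:R)) (mu - n%:R) nSn) => //.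
  + by rewrite subrK.
  + by have := shifted_bernoulli_set1 n%:R false Delta01; rewrite addr0.
  + by have := shifted_bernoulli_set1 n%:R true Delta01; rewrite natr1.
Qed.
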